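(* If $\kappa$ is a weakly compact cardinal, then for every meta-ordinal term $t$ having only ordinals less than $\kappa$, the cardinal $\kappa$ is $t$-Mahlo.
   Context: A cardinal $\kappa$ is weakly compact if and only if it is uncountable and satisfies $\kappa\to(\kappa)^2_2$; equivalently, $\kappa$ is inaccessible and has the tree property (every tree of height $\kappa$ whose levels have cardinality less than $\kappa$ has a branch of length $\kappa$). An infinite cardinal $\kappa$ is Mahlo if and only if the set of inaccessible (uncountable regular strong limit) cardinals below $\kappa$ is stationary in $\kappa$. Meta-ordinal terms: $\Omega$ is a formal symbol (standing for the order type of Ord). A meta-ordinal term is a formal finite expression $t=\Omega^{\alpha}\cdot\beta+\Omega^{\eta}\cdot\gamma+\dots+\Omega\cdot\delta+\sigma$ with exponents $\alpha>\eta>\dots$ strictly decreasing ordinals and coefficients $\beta,\gamma,\dots,\delta,\sigma$ ordinals. Terms are ordered lexicographically as in Cantor normal form: first compare the highest powers of $\Omega$; if equal, compare their coefficients; if equal, compare the next highest powers of $\Omega$, and so on. ''The ordinals of $t$'' are the exponents and coefficients occurring in $t$. Definition (by recursion): if $t$ is a meta-ordinal term having only ordinals less than $\kappa$, then a cardinal $\kappa$ is $t$-Mahlo if and only if $\kappa$ is Mahlo and for every meta-ordinal term $s<t$ having only ordinals less than $\kappa$, the set of $s$-Mahlo cardinals below $\kappa$ is stationary in $\kappa$. *)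

(* Defs.v *)
From mathcomp Require Import all_boot all_order.
From mathcomp Require Import all_classical.

Set Implicit Arguments.
Unset Strict Implicit.
Unset Printing Implicit Defensive.

Import Order.TTheory.
Local Open Scope classical_set_scope.
Local Open Scope card_scope.
Local Open Scope order_scope.

(* Ordinals are the elements of a totally ordered type O whose strict order is
   assumed well-founded.  Every ordinal is the order type of an initial segment
   of some such O, and each notion below, taken at an element k of O, depends
   only on the well-order of the elements below k: k stands for the ordinal
   that is the order type of [below k]. *)

Section Cardinals.
Context {d : Order.disp_t} {O : orderType d}.
Implicit Types (k l a b : O) (C S X : set O).

Definition below k : set O := [set a | a < k].

Definition card_lt T U (A : set T) (B : set U) : Prop :=
  (A #<= B) /\ ~ (B #<= A).

(* initial ordinals *)
Definition cardinal k : Prop := forall a, a < k -> card_lt (below a) (below k).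

Definition infinite_cardinal k : Prop := cardinal k /\ infinite_set (below k).

Definition uncountable_cardinal k : Prop := cardinal k /\ ~ countable (below k).

(* The inequality c < a below is strict, so that [unbounded_in X a] fails for
   successor a; it holds vacuously for the least element of O. *)
Definition unbounded_in X k : Prop :=
  forall a, a < k -> exists2 b, X b & a < b < k.

Definition regular_cardinal k : Prop :=
  infinite_cardinal k /\
  forall X, X `<=` below k -> unbounded_in X k -> ~ card_lt X (below k).

Definition strong_limit_cardinal k : Prop :=
  infinite_cardinal k /\
  forall l, l < k -> cardinal l ->
    card_lt [set X : set O | X `<=` below l] (below k).

Definition inaccessible k : Prop :=
  [/\ uncountable_cardinal k, regular_cardinal k & strong_limit_cardinal k].

Definition closed_in C k : Prop :=
  forall a, a < k -> (exists b, b < a) -> unbounded_in C a -> C a.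

Definition club_in C k : Prop :=
  [/\ C `<=` below k, unbounded_in C k & closed_in C k].

Definition stationary_in S k : Prop :=
  forall C, club_in C k -> exists2 l, C l & S l.

Definition mahlo k : Prop :=
  infinite_cardinal k /\ stationary_in [set l | l < k /\ inaccessible l] k.

(* k -> (k)^2_2: the colouring f is only ever used on pairs x < y below k,
   which represent the two-element subsets {x, y} of k. *)
Definition arrows_2_2 k : Prop :=
  forall f : O -> O -> bool, exists2 H : set O,
    H `<=` below k /\ H #= below k &
    exists i : bool, forall x y, H x -> H y -> x < y -> f x y = i.

Definition weakly_compact k : Prop := uncountable_cardinal k /\ arrows_2_2 k.

End Cardinals.

(* The term Omega^a1 * b1 + ... + Omega^an * bn is the sequence of the pairs
   (ai, bi), exponent first; Omega * delta and sigma are the cases where the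
   exponent is 1 and 0.  As in Cantor normal form, zero coefficients are not
   written, so that the empty sequence is the term 0; "c is not zero" is
   expressed by the existence of an element below c. *)
Record meta_term (d : Order.disp_t) (O : orderType d) := MetaTerm {
  mt_seq : seq (O * O);
  mt_exponents_decr : sorted (fun a b : O => b < a) (unzip1 mt_seq);
  mt_coefficients_neq0 : forall p, p \in mt_seq -> exists b : O, b < p.2
}.

Section Terms.
Context {d : Order.disp_t} {O : orderType d}.
Implicit Types (s t : meta_term O) (k l : O).

(* The lexicographic order on sequences of lexicographically ordered pairs:
   exponent, then coefficient, then the remaining terms; a proper prefix is
   smaller. *)
Definition mt_lt s t : bool :=
  (mt_seq s : seqlexi (O *l O)) < (mt_seq t : seqlexi (O *l O)).

Definition ordinals_lt t k : Prop :=
  forall p, p \in mt_seq t -> p.1 < k /\ p.2 < k.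

(* The recursion is on k (only cardinals l < k matter in the last premise), so
   over a well-founded O the predicate is the unique solution of the
   equivalence [t_mahloE].  A cardinal l is s-Mahlo only if the ordinals of s
   are less than l. *)
Inductive t_mahlo : meta_term O -> O -> Prop :=
| TMahlo t k of ordinals_lt t k & mahlo k &
    (forall s, mt_lt s t -> ordinals_lt s k ->
       stationary_in [set l | l < k /\ t_mahlo s l] k) :
    t_mahlo t k.

Lemma t_mahloE t k : t_mahlo t k <->
  [/\ ordinals_lt t k, mahlo k &
    forall s, mt_lt s t -> ordinals_lt s k ->
      stationary_in [set l | l < k /\ t_mahlo s l] k].
Proof. by split=> [[]|[]]; [split|exact: TMahlo]. Qed.

End Terms.

(* Main.v *)
Require Import Defs.
From mathcomp Require Import all_boot all_order.
From mathcomp Require Import all_classical.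
From mathcomp Require wochoice.

(* Comparing characteristic sequences lexicographically, k -> (k)^2_2 gives, for
   any k many subsets of k, an unbounded set whose tails decide all of them;
   the tails generate a k-complete filter, which can be pushed forward to one
   that is normal for k many prescribed functions.  Such a filter contains the
   clubs and the set of inaccessibles, and, given k many stationary sets P_x, the
   set of the l < k in which every P_x with x of rank below l is stationary.
   Induction on t, along the well-founded order of the terms, concludes: for
   s < t, if k is s-Mahlo then the P_r = {r-Mahlo cardinals}, r < s, are
   stationary in k, so filter-many l < k are s-Mahlo. *)

Set Implicit Arguments.
Unset Strict Implicit.
Unset Printing Implicit Defensive.

Import Order.TTheory.
Local Open Scope classical_set_scope.
Local Open Scope card_scope.
Local Open Scope order_scope.

(** * Comparison of cardinalities *)

Lemma card_le_inj T U (A : set T) (B : set U) (f : T -> U) :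
  (forall x, A x -> B (f x)) ->
  (forall x y, A x -> A y -> f x = f y -> x = y) -> A #<= B.
Proof.
move=> fAB finj; have [g] : $|{injfun A >-> B}|.
  by apply/injfunPex; exists f => // x y; rewrite !inE; exact: finj.
exact: inj_card_le g.
Qed.

Lemma card_le_injE T U (u0 : U) (A : set T) (B : set U) : A #<= B ->
  exists f : T -> U, (forall x, A x -> B (f x)) /\
    (forall x y, A x -> A y -> f x = f y -> x = y).
Proof.
elim/Ppointed: U => U in u0 B *; first by case: (no u0).
move=> /pcard_leP/injfunPex[f fAB finj]; exists f; split=> // x y Ax Ay.
by apply: finj; rewrite inE.
Qed.

Lemma card_le_surj T U (A : set T) (B : set U) (f : T -> U) :
  (forall y, B y -> exists2 x, A x & f x = y) -> B #<= A.
Proof.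
move=> fAB; apply: card_le_trans (card_image_le f A); apply: subset_card_le.
by move=> y /fAB[x Ax <-]; exists x.
Qed.

(** Hilbert's hotel: a copy [e] of the natural numbers inside [A] is shifted down by one, which
    frees [e 0] to be sent to [a]. *)
Lemma card_le_setU1 T (a : T) (A : set T) : infinite_set A -> (a |` A) #<= A.
Proof.
move=> /infiniteP/(card_le_injE a)[e [eA einj]].
pose h x := if pselect (exists n, x = e n.+1) is left ex then e (projT1 (cid ex))
            else if pselect (x = e 0%N) then a else x.
apply: (@card_le_surj _ _ _ _ h) => y.
have hS n : h (e n.+1) = e n.
  rewrite /h; case: pselect => [ex|[]]; last by exists n.
  by case: cid => m /= /(einj _ _ I I)[->].
have [[n ->] _|yne] := pselect (exists n, y = e n).
  by exists (e n.+1); [exact: eA|exact: hS].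
move=> [->|Ay].
  exists (e 0%N); first exact: eA.
  rewrite /h; case: pselect => [[n /(einj _ _ I I)]|_] //.
  by case: pselect.
exists y => //; rewrite /h; case: pselect => [[n yn]|_].
  by case: yne; exists n.+1.
by case: pselect => // y0; case: yne; exists 0%N.
Qed.

(** * Least elements and comparability *)

Section WellOrder.
Context {d : Order.disp_t} {O : orderType d}.
Hypothesis wfO : well_founded (fun a b : O => a < b).
Implicit Types (k l a b : O) (X : set O).

Lemma ex_least X : (exists a, X a) -> exists2 a, X a & forall b, X b -> a <= b.
Proof.
apply: contraPP => nmin [a Xa]; elim/(well_founded_ind wfO): a Xa => a IH Xa.
case: nmin; exists a => // b Xb; rewrite leNgt; apply/negP => /IH; exact.
Qed.

Lemma ex_bottom a : exists o0 : O, forall b, o0 <= b.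
Proof.
by have [|o0 _ o0P] := @ex_least setT; [exists a|exists o0 => b; exact: o0P].
Qed.

Lemma not_unbounded X k :
  ~ unbounded_in X k -> exists2 a, a < k & forall b, X b -> b < k -> b <= a.
Proof.
move=> /existsNP[a /not_implyP[ak nX]]; exists a => // b Xb bk.
by rewrite leNgt; apply/negP => ab; apply: nX; exists b; rewrite ?ab.
Qed.

(* Enumerating A along O either exhausts A before stage l or injects the
   elements below l into A. *)
Lemma card_le_total T (A : set T) l :
  below l #<= A \/ exists2 a, a < l & A #<= below a.
Proof.
have [[t0 At0]|A0] := pselect (exists t, A t); last first.
  have A0' : A = set0 by apply/seteqP; split=> // t At; case: A0; exists t.
  have [[a al]|l0] := pselect (exists a, a < l).
    by right; exists a => //; rewrite A0'; exact: card_ge0.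
  left; apply: (@card_le_trans _ _ _ (@set0 O)); last exact: card_ge0.
  by apply: subset_card_le => a al; case: l0; exists a.
have [e eP] : exists e : O -> T, forall a,
    (exists2 t, A t & forall b, b < a -> e b <> t) ->
    A (e a) /\ forall b, b < a -> e b <> e a.
  (* [F] picks an element of [A] not listed before stage [a]; [t0] is the value once [A] is
     exhausted. *)
  pose P a (r : forall b, b < a -> T) t := A t /\ forall b ba, r b ba <> t.
  pose F a (r : forall b, b < a -> T) : T :=
    if pselect (exists t, P a r t) is left ex then projT1 (cid ex) else t0.
  exists (Fix wfO (fun=> T) F) => a [t At tP].
  have -> : Fix wfO (fun=> T) F a = F a (fun b _ => Fix wfO (fun=> T) F b).
    apply: Fix_eq => x f g fg; congr F.
    by apply/functional_extensionality_dep => y;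
       apply/functional_extensionality_dep => p; exact: fg.
  rewrite /F; case: pselect => [ex|[]]; last by exists t; split.
  by case: cid => u /= [].
have [ex|nex] := pselect (exists2 a, a < l & forall t, A t -> exists2 b, b < a & e b = t).
  right; case: ex => a al aP; exists a => //.
  exact: (@card_le_surj _ _ (below a) A e).
left.
have eA a : a < l -> A (e a) /\ forall b, b < a -> e b <> e a.
  move=> al; apply: eP; apply: contra_notP nex => nt; exists a => // t At.
  apply: contra_notP nt => nb; exists t => // b ba ebt; apply: nb; by exists b.
apply: (@card_le_inj _ _ _ _ e) => [a /eA[]//|a b al bl ab].
case: (ltgtP a b) => // [/(eA _ bl).2|/(eA _ al).2] //.
by rewrite ab.
Qed.

End WellOrder.

(** * Sets with fewer than k elements *)

Section Small.
Context {d : Order.disp_t} {O : orderType d}.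
Implicit Types (k l a b : O) (X : set O).

(** Were [a] the largest element below [k], then [below k] would be finite or of the same size as an
    infinite [below a]. *)
Lemma infinite_cardinal_limit k a : infinite_cardinal k -> a < k ->
  exists2 b, a < b & b < k.
Proof.
move=> [ck ik] ak; apply: contrapT => nb.
have ka : below k `<=` a |` below a.
  move=> x xk; have [xa|ax|->] := ltgtP x a; [by right| |by left].
  by case: nb; exists x.
have [fa|ia] := pselect (finite_set (below a)).
  by apply: ik; apply: sub_finite_set ka _; rewrite finite_setU; split.
apply: (ck _ ak).2; apply: card_le_trans (card_le_setU1 a ia).
exact: subset_card_le.
Qed.

Lemma uncountable_infinite k : uncountable_cardinal k -> infinite_cardinal k.
Proof. by case=> ck uk; split=> // /finite_set_countable. Qed.

(* Colour a pair according to whether an element of X separates it. *)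
Lemma weakly_compact_unbounded k X : weakly_compact k ->
  X `<=` below k -> unbounded_in X k -> below k #<= X.
Proof.
move=> [uk ak] Xk Xunb; have [ck ik] := uncountable_infinite uk.
have /choice[g gP] a : exists b, a < k -> X b /\ a < b.
  have [/Xunb[b Xb /andP[ab _]]|nak] := pselect (a < k); first by exists b.
  by exists a.
have [H [Hk Hcard] [c Hc]] := ak (fun x y => `[< y < g x >]).
have kH : below k #<= H by move: Hcard; rewrite card_eq_le => /andP[].
have [h Hh] : exists h, H h.
  apply: contrapT => H0; have H0' : H = set0.
    by apply/seteqP; split=> // x Hx; case: H0; exists x.
  by apply: ik; rewrite H0' in kH; apply: (card_le_finite kH).
(* With colour true, every element of [H] lies below [g h], so [H] is too small; with colour false,
   [g] is strictly increasing on [H] and injects it into [X]. *)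
case: c Hc => Hc.
  have ghk := Xk _ (gP _ (Hk _ Hh)).1.
  exfalso; apply: (ck _ ghk).2; apply: card_le_trans kH _.
  apply: subset_card_le => y Hy; rewrite /below /=.
  have [yh|hy|->] := ltgtP y h; last exact: (gP _ (Hk _ Hh)).2.
    by apply: lt_trans yh (gP _ (Hk _ Hh)).2.
  by have /asboolP := Hc _ _ Hh Hy hy.
apply: card_le_trans kH _; apply: (@card_le_inj _ _ _ _ g) => [x /Hk/gP[]//|].
have gmono x y : H x -> H y -> x < y -> g x < g y.
  move=> Hx Hy xy; apply: le_lt_trans (gP _ (Hk _ Hy)).2; rewrite leNgt.
  by apply/negP => ygx; have /asboolP := Hc _ _ Hx Hy xy.
move=> x y Hx Hy gxy; have [/gmono|/gmono|//] := ltgtP x y.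
  by rewrite gxy ltxx => /(_ Hx Hy).
by rewrite gxy ltxx => /(_ Hy Hx).
Qed.

(* For regular k, this expresses that A has fewer than k elements, in a form that
   makes sense for every type I. *)
Definition small k I (A : set I) : Prop :=
  forall g : I -> O, (forall i, A i -> g i < k) ->
  exists2 b, b < k & forall i, A i -> g i <= b.

Variable k : O.
Hypothesis wc : weakly_compact k.

Lemma wc_limit a : a < k -> exists2 b, a < b & b < k.
Proof. by apply: infinite_cardinal_limit; apply: uncountable_infinite; case: wc. Qed.

Lemma wc_ex : exists a, a < k.
Proof.
have [_ /infinite_setN0[a ak]] := uncountable_infinite wc.1; by exists a.
Qed.

(** This carries the regularity of [k]: an unbounded image of [A] would have k elements by
    [weakly_compact_unbounded]. *)
Lemma small_card I (A : set I) : ~ (below k #<= A) -> small k A.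
Proof.
move=> nkA g gk; pose X := g @` A.
have Xk : X `<=` below k by move=> _ [i Ai <-]; exact: gk.
have [Xunb|/not_unbounded[b bk bP]] := pselect (unbounded_in X k).
  case: nkA; apply: card_le_trans (weakly_compact_unbounded wc Xk Xunb) _.
  exact: card_image_le.
by exists b => // i Ai; apply: bP; [exists i|exact: gk].
Qed.

Lemma small_below a : a < k -> small k (below a).
Proof. by move=> ak; apply: small_card; have [[ck _] _] := wc; case: (ck _ ak). Qed.

Lemma small_countable I (A : set I) : countable A -> small k A.
Proof.
move=> cA; apply: small_card => kA; apply: wc.1.2.
exact: sub_countable kA cA.
Qed.

Lemma small_sub I (A B : set I) : A `<=` B -> small k B -> small k A.
Proof.
move=> AB sB g gk; have [o0 o0k] := wc_ex.
have [|b bk bP] := sB (fun i => if pselect (A i) then g i else o0).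
  by move=> i Bi; case: pselect => [Ai|//]; exact: gk.
by exists b => // i Ai; have := bP _ (AB _ Ai); case: pselect.
Qed.

Lemma small_image I J (h : I -> J) (A : set I) : small k A -> small k (h @` A).
Proof.
move=> sA g gk; have [|b bk bP] := sA (g \o h); first by move=> i Ai; apply: gk; exists i.
by exists b => // _ [i Ai <-]; exact: bP.
Qed.

Lemma small_bigcup I J (N : set I) (A : I -> set J) :
  small k N -> (forall i, N i -> small k (A i)) ->
  small k [set j | exists2 i, N i & A i j].
Proof.
move=> sN sA g gk.
have /choice[b bP] i : exists b, N i -> b < k /\ forall j, A i j -> g j <= b.
  have [Ni|nNi] := pselect (N i); last by exists k.
  have [|b bk bP] := sA _ Ni g; first by move=> j Aij; apply: gk; exists i.
  by exists b.
have [|c ck cP] := sN b; first by move=> i Ni; case: (bP _ Ni).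
exists c => // j [i Ni Aij]; apply: le_trans (cP _ Ni).
by case: (bP _ Ni) => _; apply.
Qed.

Lemma small_setU I (A B : set I) : small k A -> small k B -> small k (A `|` B).
Proof.
move=> sA sB; have sT : small k [set: bool] by apply: small_countable.
have sAB := @small_bigcup _ _ _ (fun b : bool => if b then A else B) sT.
apply: small_sub _ (sAB _); last by case.
by move=> i [Ai|Bi]; [exists true|exists false].
Qed.

Lemma small_le a : a < k -> small k [set b | b <= a].
Proof.
move=> /wc_limit[b ab bk]; apply: small_sub _ (small_below bk) => c /=.
by move=> ca; apply: le_lt_trans ab.
Qed.

Lemma small_setX I J (A : set I) (B : set J) :
  small k A -> small k B -> small k (A `*` B).
Proof.
move=> sA sB; have sAB := small_bigcup sA (fun i _ => small_image (h := pair i) sB).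
apply: small_sub _ sAB.
by move=> [i j] [/= Ai Bj]; exists i => //; exists j.
Qed.

(** The fold says that all entries lie in [A]. The lengths split the sequences into countably many
    small classes, and countable unions stay small because [k] is uncountable. *)
Lemma small_seq I (A : set I) : small k A ->
  small k [set s : seq I | foldr (fun i P => A i /\ P) True s].
Proof.
move=> sA; pose S n s := size s = n /\ foldr (fun i P => A i /\ P) True s.
have sS n : small k (S n).
  elim: n => [|n IH].
    apply: small_sub _ (small_countable (countable1 [::])).
    by move=> [|x s] [].
  have sAS := small_bigcup sA (fun i _ => small_image (h := cons i) IH).
  apply: small_sub _ sAS => -[|i s] [//= [ssz] [Ai As]].
  by exists i => //; exists s.
have sN : small k [set: nat] by apply: small_countable.
have sNS := small_bigcup sN (fun n _ => sS n).
by apply: small_sub _ sNS => s sP; exists (size s).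
Qed.

End Small.

(** * Complete filters, normal for prescribed functions *)

Section Filters.
Context {d : Order.disp_t} {O : orderType d}.
Hypothesis wfO : well_founded (fun a b : O => a < b).
Variable k : O.
Hypothesis wc : weakly_compact k.
Implicit Types (a b l m : O) (C D X Y : set O) (U : set (set O)).

(** Indices are compared by rank, and ties are broken by an arbitrary well-order of [I]. Initial
    segments then have bounded rank, which makes them small in [weakly_compact_decide]. *)
Lemma ex_well_order_rank I (rk : I -> O) : exists prec : I -> I -> Prop,
  [/\ forall X : set I, (exists i, X i) ->
        exists2 i, X i & forall j, X j -> j = i \/ prec i j,
      forall i j, prec i j -> ~ prec j i &
      forall i j, prec i j -> rk i <= rk j].
Proof.
elim/Peq: I => I in rk *; have [R Rwo] := wochoice.well_ordering_principle I.
have Rmin (X : set I) : (exists i, X i) ->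
    exists2 i, X i & forall j, X j -> R i j.
  move=> [i Xi]; have [|z [[Xz zmin] _]] := Rwo [pred j | `[< X j >]].
    by exists i; apply/asboolP.
  exists z => [|j Xj]; first exact/asboolP.
  by apply: zmin; apply/asboolP.
have Rrefl i : R i i by have [|_ -> ] := Rmin [set i]; [exists i|exact].
have Ranti i j : R i j -> R j i -> i = j.
  move=> Rij Rji; have [|z [_ zuniq]] := Rwo [pred x | (x == i) || (x == j)].
    by exists i; rewrite inE eqxx.
  rewrite -(zuniq i); first apply: zuniq.
    split; first by rewrite inE eqxx orbT.
    by move=> x; rewrite inE => /orP[] /eqP ->.
  split; first by rewrite inE eqxx.
  by move=> x; rewrite inE => /orP[] /eqP ->.
exists (fun i j => rk i < rk j \/ [/\ rk i = rk j, R i j & i <> j]).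
split=> [X [i0 Xi0]|i j [rij|[rij Rij nij]] [rji|[rji Rji nji]]|i j].
- have [|_ [i Xi <-] rkmin] := ex_least wfO (X := rk @` X).
    by exists (rk i0), i0.
  have [|z [Xz zi] zmin] := Rmin [set j | X j /\ rk j = rk i]; first by exists i.
  exists z => // j Xj; have [->|jz] := pselect (j = z); [by left|right].
  have : rk i <= rk j by apply: rkmin; exists j.
  rewrite le_eqVlt => /orP[/eqP ij|ij]; last by left; rewrite zi.
  by right; split; [rewrite zi|apply: zmin|move=> /esym].
- by have := lt_trans rij rji; rewrite ltxx.
- by rewrite rji ltxx in rij.
- by rewrite rij ltxx in rji.
- by apply: nij; exact: Ranti.
- by case=> [/ltW //|[-> _ _]].
Qed.

(* Sierpinski's argument: compare the characteristic sequences of the points of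
   k lexicographically.  On a homogeneous set they are monotone, hence every
   coordinate is eventually constant. *)
Lemma weakly_compact_decide I (rk : I -> O) (A : I -> set O) :
  (forall a, a < k -> small k [set i | rk i <= a]) ->
  exists2 H : set O, H `<=` below k /\ unbounded_in H k &
    forall i, rk i < k -> exists2 b, b < k &
      (forall l, H l -> b < l -> A i l) \/ (forall l, H l -> b < l -> ~ A i l).
Proof.
move=> srk; have [prec [pmin pasym prk]] := ex_well_order_rank rk.
(* [i] is the [prec]-first coordinate at which the characteristic sequences of [l] and [m] differ,
   and that of [l] is the smaller one there. *)
pose P l m i := [/\ rk i < k, A i m, ~ A i l &
  forall j, prec j i -> A j l <-> A j m].
have [H [Hk Hcard] [c Hc]] := wc.2 (fun l m => `[< exists i, P l m i >]).
have Hunb : unbounded_in H k.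
  apply: contrapT => /not_unbounded[a ak aP].
  have [b ab bk] := wc_limit wc ak.
  apply: (wc.1.1 _ bk).2; move: Hcard; rewrite card_eq_le => /andP[_ kH].
  apply: card_le_trans kH _; apply: subset_card_le => h Hh.
  by apply: le_lt_trans ab; apply: aP => //; exact: Hk.
exists H => //; apply: contrapT => nall.
pose dec i b := (forall l, H l -> b < l -> A i l) \/
                (forall l, H l -> b < l -> ~ A i l).
have [|i [ik nic] imin] := pmin [set i | rk i < k /\ ~ exists2 b, b < k & dec i b].
  apply: contra_notP nall => nX i ik; apply: contrapT => nd; apply: nX.
  by exists i.
have /choice[b bP] j : exists b, prec j i -> b < k /\ dec j b.
  have [pji|npji] := pselect (prec j i); last by exists k.
  have [|nd] := pselect (exists2 b, b < k & dec j b).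
    by case=> b bk bP; exists b.
  have jk := le_lt_trans (prk _ _ pji) ik.
  case: (imin j) => // [ji|/pasym//]; exfalso.
  by rewrite ji in pji; exact: pasym (pji) (pji).
have sprec : small k [set j | prec j i].
  by apply: small_sub wc _ _ _ _ (srk _ ik) => j /prk.
have [|b0 b0k b0P] := sprec b; first by move=> j /bP[].
have agree j l m : prec j i -> H l -> H m -> b0 < l -> b0 < m ->
    A j l <-> A j m.
  move=> pji Hl Hm bl bm; have [_ dj] := bP _ pji.
  have bl' := le_lt_trans (b0P _ pji) bl.
  have bm' := le_lt_trans (b0P _ pji) bm.
  by case: dj => dj; split=> Aj; have := dj _ Hl bl'; have := dj _ Hm bm'.
have nA a : a < k -> exists2 l, H l /\ a < l & ~ A i l.
  move=> ak; apply: contrapT => nl; apply: nic; exists a => //; left=> l Hl al.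
  by apply: contrapT => nAl; apply: nl; exists l.
have pA a : a < k -> exists2 l, H l /\ a < l & A i l.
  move=> ak; apply: contrapT => nl; apply: nic; exists a => //; right=> l Hl al.
  by move=> nAl; apply: nl; exists l.
(* At [l1 < l2 < l3] the least undecided coordinate [i] is false, true, false, while the earlier
   ones are constant on [H] past [b0]. So the pair [l1, l2] gets colour true; but a first difference
   [i'] giving [l2, l3] the same colour can be neither before [i], nor equal to it, nor after it. *)
have [l1 [H1 bl1] A1] := nA _ b0k.
have [l2 [H2 l12] A2] := pA _ (Hk _ H1).
have [l3 [H3 l23] A3] := nA _ (Hk _ H2).
have bl2 := lt_trans bl1 l12; have bl3 := lt_trans bl2 l23.
have c1 : c = true.
  rewrite -(Hc _ _ H1 H2 l12); apply/asboolP; exists i; split=> // j pji.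
  exact: agree.
have /asboolP[i' [_ A'3 A'2 i'P]] : `[< exists i, P l2 l3 i >] by rewrite Hc.
have [|i0 i0i i0P] := pmin [set j | j = i \/ j = i']; first by exists i; left.
case: i0i i0P => -> i0P.
  case: (i0P i') => [|ii'|pii']; first by right.
    by apply: A'2; rewrite ii'.
  by apply: A3; apply/(i'P _ pii').
case: (i0P i) => [|ii'|pii']; first by left.
  by apply: A'2; rewrite -ii'.
by apply: A'2; apply/(agree _ _ _ pii' H2 H3 bl2 bl3).
Qed.

Definition complete_filter U : Prop :=
  [/\ forall X Y, X `<=` Y -> U X -> U Y,
      forall X, U X -> exists x, X x,
      forall a, a < k -> U [set x | a < x < k] &
      forall I (A : set I) (X : I -> set O), small k A ->
        (forall i, A i -> U (X i)) -> U [set x | forall i, A i -> X i x]].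

Lemma complete_filterI U X Y : complete_filter U -> U X -> U Y -> U (X `&` Y).
Proof.
move=> [Usub _ _ Ucap] UX UY.
have sT : small k [set: bool] by apply: small_countable.
have : U [set x | forall b : bool, [set: bool] b -> (if b then X else Y) x].
  by apply: (Ucap _ _ (fun b : bool => if b then X else Y)) => // -[].
by apply: Usub => x xP; split; [exact: (xP true)|exact: (xP false)].
Qed.

Lemma complete_filter_tail H : H `<=` below k -> unbounded_in H k ->
  complete_filter [set X | exists2 b, b < k & forall l, H l -> b < l -> X l].
Proof.
move=> Hk Hunb; split=> [X Y XY [b bk bP]|X [b bk bP]|a ak|I A X sA XP].
- by exists b => // l Hl bl; apply: XY; exact: bP.
- by have [x Hx /andP[bx _]] := Hunb _ bk; exists x; exact: bP.
- by exists a => // l Hl al; rewrite /= al; exact: Hk.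
have /choice[b bP] i : exists b, A i -> b < k /\ forall l, H l -> b < l -> X i l.
  have [/XP[b bk bP]|nAi] := pselect (A i); last by exists k.
  by exists b.
have [|b0 b0k b0P] := sA b; first by move=> i /bP[].
exists b0 => // l Hl bl i Ai; apply: (bP _ Ai).2 => //.
exact: le_lt_trans (b0P _ Ai) bl.
Qed.

Lemma complete_filter_image U (f : O -> O) : complete_filter U ->
  (forall b, b < k -> U [set l | b < f l < k]) ->
  complete_filter [set X | U (f @^-1` X)].
Proof.
move=> [Usub U0 Uk Ucap] fP; split=> [X Y XY|X /U0[x]|//|I A X sA XP].
- by apply: Usub => x; exact: XY.
- by exists (f x).
- exact: Ucap.
Qed.

(** Normality and ultrafilter behaviour are asked only for the listed functions and sets, since a
    weakly compact cardinal need not be measurable. *)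
Definition decides U J (rk : J -> O) (g : J -> O -> O) (p : J -> set O) : Prop :=
  forall j, rk j < k ->
    (U [set l | g j l < l] -> exists a, U [set l | g j l = a]) /\
    (U (p j) \/ U (~` p j)).

(** This expresses, without an enumeration, that at most k many indices have rank below [k], and
    that fewer than k are met up to any given rank. *)
Definition ranked J (rk : J -> O) : Prop :=
  forall a, a < k -> small k [set j | rk j <= a].

Lemma ranked_seq J (rk : J -> O) (o0 : O) : ranked rk ->
  ranked (foldr (fun j => Order.max (rk j)) o0).
Proof.
move=> rrk a ak; apply: small_sub wc _ _ _ _ (small_seq wc (rrk _ ak)).
by elim=> //= j w IH; rewrite /= ge_max => /andP[ja wa]; split=> //; exact: IH.
Qed.

Lemma ranked_pair I J (rkI : I -> O) (rkJ : J -> O) : ranked rkI -> ranked rkJ ->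
  ranked (fun p => Order.max (rkI p.1) (rkJ p.2)).
Proof.
move=> rI rJ a ak; apply: small_sub wc _ _ _ _ (small_setX wc (rI _ ak) (rJ _ ak)).
by move=> [i j] /=; rewrite ge_max => /andP[].
Qed.

Lemma ranked_sum I J (rkI : I -> O) (rkJ : J -> O) : ranked rkI -> ranked rkJ ->
  ranked (fun x => match x with inl i => rkI i | inr j => rkJ j end).
Proof.
move=> rI rJ a ak.
have sI := small_image (h := @inl I J) (rI _ ak).
have sJ := small_image (h := @inr I J) (rJ _ ak).
apply: small_sub wc _ _ _ _ (small_setU wc sI sJ).
by move=> [i|j] ija; [left; exists i|right; exists j].
Qed.

Lemma ranked_id : ranked (fun a : O => a).
Proof. by move=> a ak; exact: small_le. Qed.

Lemma ranked_unit a : ranked (fun _ : unit => a).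
Proof. by move=> b bk; apply: small_countable wc _ _ _. Qed.

(* The tails of a set deciding enough predicates form a complete filter U.  Among
   the compositions F_w of the functions g that tend to k along U, take one that
   is minimal modulo U: it exists because U is countably complete.  Its image
   filter is normal for the functions g, since composing it with a regressive
   g_j gives a smaller function, which is bounded, hence constant modulo U. *)
Lemma normal_filter J (rk : J -> O) (g : J -> O -> O) (p : J -> set O) :
  ranked rk -> exists2 U, complete_filter U & decides U rk g p.
Proof.
move=> rrk; have [o0 o0P] := ex_bottom wfO k.
have o0k : o0 < k.
  by have [a ak] := wc_ex wc; exact: le_lt_trans ak.
pose rkw := foldr (fun j => Order.max (rk j)) o0.
pose F w l := foldr g l w.
(* [H] has to decide the pull-backs of the [p j] along each composition [F w], and the level sets of
   each [F w]. *)
pose A (i : (J + O) * seq J) : set O := match i.1 with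
  | inl j => [set l | p j (F i.2 l)] | inr b => [set l | F i.2 l = b] end.
have rA := ranked_pair (ranked_sum rrk ranked_id) (ranked_seq (o0 := o0) rrk).
have [H [Hk Hunb] HA] := weakly_compact_decide A rA.
pose U0 := [set X | exists2 b, b < k & forall l, H l -> b < l -> X l].
have FU : complete_filter U0 by exact: complete_filter_tail.
have [Usub Une Uk Ucap] := FU.
have dec_p j w : rk j < k -> rkw w < k ->
    U0 [set l | p j (F w l)] \/ U0 (~` [set l | p j (F w l)]).
  move=> jk wk; have [|b bk [bP|bP]] := HA (inl j, w); first by rewrite gt_max jk.
    by left; exists b.
  by right; exists b.
have dec_F w a : rkw w < k -> a < k ->
    U0 [set l | F w l = a] \/ U0 (~` [set l | F w l = a]).
  move=> wk ak; have [|b bk [bP|bP]] := HA (inr a, w); first by rewrite gt_max ak.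
    by left; exists b.
  by right; exists b.
pose good w := rkw w < k /\ forall b, b < k -> U0 [set l | b < F w l < k].
have good0 : good [::] by split=> // b; exact: Uk.
have [w [wk wP] wmin] : exists2 w, good w &
    forall w', good w' -> ~ U0 [set l | F w' l < F w l].
  (* Otherwise iterating [next] gives countably many sets of the filter, and a common point [l] of
     them yields an infinite descent in [O]. *)
  apply: contrapT => nmin.
  have /choice[next nextP] w : exists w', good w ->
      good w' /\ U0 [set l | F w' l < F w l].
    have [gw|ngw] := pselect (good w); last by exists [::].
    apply: contra_notP nmin => nw; exists w => // w' gw' Uw'.
    by apply: nw; exists w'.
  have gn n : good (iter n next [::]) by elim: n => // n /nextP[].
  have sN : small k [set: nat] by apply: small_countable.
  have /Une[l lP] := Ucap _ _ _ sN (fun n _ => (nextP _ (gn n)).2).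
  have [|_ [n _ <-] nP] := ex_least wfO
      (X := (fun n => F (iter n next [::]) l) @` [set: nat]).
    by exists l, 0%N.
  have := lP n I; rewrite /= ltNge => /negP; apply.
  by apply: nP; exists n.+1.
exists [set X | U0 (F w @^-1` X)]; first exact: complete_filter_image.
move=> j jk; split; last exact: dec_p.
have wjk : rkw (j :: w) < k by rewrite /= gt_max jk.
move=> Ureg; have Ureg' : U0 [set l | F (j :: w) l < F w l] by [].
have Fk : U0 [set l | F (j :: w) l < k].
  apply: Usub (complete_filterI FU Ureg' (wP _ o0k)).
  by move=> l /= [lt1 /andP[_]]; exact: lt_trans.
apply: contrapT => nconst; apply: wmin Ureg'; split=> // b bk.
(* No value is taken almost everywhere, so each [a <= b] is avoided almost everywhere, and by
   completeness all are avoided at once. Hence [j :: w] is good, against the minimality of [w]. *)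
have Fb : U0 [set l | forall a, a <= b -> F (j :: w) l <> a].
  apply: (Ucap _ [set a | a <= b] (fun a => [set l | F (j :: w) l <> a])).
    exact: ranked_id.
  move=> a ab; have [//|Ua|//] := dec_F (j :: w) a wjk.
    exact: le_lt_trans bk.
  by case: nconst; exists a.
apply: Usub (complete_filterI FU Fk Fb) => l [/= lk lP]; rewrite lk andbT ltNge.
by apply/negP => /lP; exact.
Qed.

(* The family (g, p) is part of the existential so that finitely many
   requirements on a normal filter can be met at once. *)
Definition forced (Phi : set (set O) -> Prop) : Prop :=
  exists (J : Type) (rk : J -> O) (g : J -> O -> O) (p : J -> set O),
    ranked rk /\ forall U, complete_filter U -> decides U rk g p -> Phi U.

Lemma forced_regressive J (rk : J -> O) (g : J -> O -> O) : ranked rk ->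
  forced (fun U => forall j, rk j < k -> U [set l | g j l < l] ->
    exists a, U [set l | g j l = a]).
Proof.
move=> rrk; exists J, rk, g, (fun=> setT); split=> // U _ dU j /dU[]; exact.
Qed.

Lemma forced_decide J (rk : J -> O) (p : J -> set O) : ranked rk ->
  forced (fun U => forall j, rk j < k -> U (p j) \/ U (~` p j)).
Proof.
move=> rrk; exists J, rk, (fun=> id), p; split=> // U _ dU j /dU[].
by move=> _; exact.
Qed.

Lemma forced_and Phi Psi : forced Phi -> forced Psi ->
  forced (fun U => Phi U /\ Psi U).
Proof.
move=> [I [rI [gI [pI [rrI PhiP]]]]] [J [rJ [gJ [pJ [rrJ PsiP]]]]].
exists (I + J)%type, (fun x => match x with inl i => rI i | inr j => rJ j end).
exists (fun x => match x with inl i => gI i | inr j => gJ j end).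
exists (fun x => match x with inl i => pI i | inr j => pJ j end).
split=> [|U FU dU]; first exact: ranked_sum.
split; first by apply: PhiP => // i; exact: (dU (inl i)).
by apply: PsiP => // j; exact: (dU (inr j)).
Qed.

Lemma forced_imp (Phi Psi : set (set O) -> Prop) :
  (forall U, complete_filter U -> Phi U -> Psi U) -> forced Phi -> forced Psi.
Proof.
move=> PhiPsi [J [rk [g [p [rrk PhiP]]]]]; exists J, rk, g, p; split=> // U FU dU.
by apply: PhiPsi => //; exact: PhiP.
Qed.

Lemma forced_ex Phi : forced Phi -> exists2 U, complete_filter U & Phi U.
Proof.
move=> [J [rk [g [p [rrk PhiP]]]]]; have [U FU dU] := normal_filter g p rrk.
by exists U => //; exact: PhiP.
Qed.

End Filters.

(** * Clubs and inaccessibles in normal filters *)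

Section Forced.
Context {d : Order.disp_t} {O : orderType d}.
Hypothesis wfO : well_founded (fun a b : O => a < b).
Variable k : O.
Hypothesis wc : weakly_compact k.
Implicit Types (a b l m : O) (C D X Y : set O) (U : set (set O)).

(** Otherwise almost every [l] lies outside [C], and closedness bounds [C] below [l] by some
    [g l < l]. This bound is constant modulo [U], although [C] is unbounded in [k]. *)
Lemma forced_club C : club_in C k -> forced k (fun U => U C).
Proof.
move=> [Ck Cunb Ccl]; have [o0 o0k] := wc_ex wc.
have /choice[g gP] l : exists b, l < k -> ~ C l -> (exists a, a < l) ->
    b < l /\ forall c, C c -> c < l -> c <= b.
  have [[lk [nCl l0]]|nl] := pselect (l < k /\ ~ C l /\ exists a, a < l).
    have [/(Ccl _ lk l0)//|/not_unbounded[b bl bP]] := pselect (unbounded_in C l).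
    by exists b.
  by exists l => lk nCl l0; case: nl.
apply: forced_imp (forced_and wc
  (forced_regressive (fun _ : unit => g) (ranked_unit wc (a := o0)))
  (forced_decide (fun _ : unit => C) (ranked_unit wc (a := o0)))).
move=> U FU [/(_ tt o0k) reg /(_ tt o0k)[//|nC]].
have [Usub Une Uk _] := FU.
have UP : U [set l | [/\ l < k, ~ C l, g l < l & forall c, C c -> c < l -> c <= g l]].
  apply: Usub (complete_filterI wc FU nC (Uk _ o0k)) => l [nCl /andP[l0 lk]].
  by have [|gl glP] := gP _ lk nCl; [exists o0|split].
have [|a Ua] := reg; first by apply: Usub UP => l [].
have /Une[l [[lk _ gl _] gla]] := complete_filterI wc FU UP Ua.
have ak : a < k by rewrite -gla; exact: lt_trans lk.
have [c Cc /andP[ac ck]] := Cunb _ ak.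
have /Une[m [[[_ _ _ mP] gma] /andP[cm _]]] :=
  complete_filterI wc FU (complete_filterI wc FU UP Ua) (Uk _ ck).
by have := mP _ Cc cm; rewrite gma leNgt ac.
Qed.

(** For an injection [i] of k into the subsets of [a], a filter deciding whether [b] belongs to
    [i l], for each [b < a], makes [i l] constant almost everywhere. *)
Lemma weakly_compact_power a : a < k ->
  ~ (below k #<= [set X : set O | X `<=` below a]).
Proof.
move=> ak /(card_le_injE set0)[i [ia iinj]].
have [U FU dU] := forced_ex wfO wc
  (forced_decide (fun b => [set l | i l b]) (ranked_id wc)).
have [Usub Une Uk Ucap] := FU.
have Ui : U [set l | forall b, b < a -> i l b <-> U [set l | i l b]].
  apply: (Ucap _ (below a) (fun b => [set l | i l b <-> U [set l | i l b]])).
    exact: (small_below wc ak).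
  move=> b ba; have [Ub|Ub] := dU _ (lt_trans ba ak).
    by apply: (Usub _ _ _ Ub) => l ib.
  apply: (Usub _ _ _ Ub) => l nib; split=> // Ub'.
  by have /Une[x []] := complete_filterI wc FU Ub Ub'.
have /Une[l [/= lP /andP[_ lk]]] := complete_filterI wc FU Ui (Uk _ ak).
have /Une[m [/= mP /andP[lm mk]]] := complete_filterI wc FU Ui (Uk _ lk).
have lm' : i l = i m.
  apply/seteqP; split=> b ib.
    by apply/mP; [exact: (ia _ lk)|apply/lP => //; exact: (ia _ lk)].
  by apply/lP; [exact: (ia _ mk)|apply/mP => //; exact: (ia _ mk)].
by have := iinj _ _ lk mk lm' => lm''; rewrite lm'' ltxx in lm.
Qed.

(** If almost every [l] injects into the subsets of a smaller ordinal, that ordinal is a fixed [a]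
    modulo [U], and the limit of the injections along [U] contradicts [weakly_compact_power]. *)
Lemma forced_power : forced k (fun U => U [set l | forall a, a < l ->
  ~ (below l #<= [set X : set O | X `<=` below a])]).
Proof.
have [o0 o0k] := wc_ex wc.
pose P l (ai : O * (O -> set O)) := [/\ ai.1 < l,
  forall x, x < l -> ai.2 x `<=` below ai.1 &
  forall x y, x < l -> y < l -> ai.2 x = ai.2 y -> x = y].
have /choice[f fP] l : exists ai, (exists ai, P l ai) -> P l ai.
  by have [[ai aiP]|nai] := pselect (exists ai, P l ai);
    [exists ai|exists (l, fun=> set0)].
pose bad l := exists ai, P l ai.
apply: forced_imp (forced_and wc
  (forced_regressive (fun _ : unit => fst \o f) (ranked_unit wc (a := o0)))
  (forced_and wc (forced_decide (fun _ : unit => bad) (ranked_unit wc (a := o0)))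
    (forced_decide (fun xy : O * O => [set l | (f l).2 xy.1 xy.2])
      (ranked_pair wc (ranked_id wc) (ranked_id wc))))).
move=> U FU [/(_ tt o0k) reg [/(_ tt o0k) decbad dec]].
have [Usub Une Uk Ucap] := FU.
case: decbad => Ubad; last first.
  apply: Usub Ubad => l nbad a al /(card_le_injE set0)[i [ia iinj]].
  by apply: nbad; exists (a, i).
have UP : U [set l | P l (f l)] by apply: Usub Ubad => l /fP.
have [|a Ua0] := reg; first by apply: (Usub _ _ _ UP) => l [].
have {Ua0}Ua : U [set l | (f l).1 = a] := Ua0.
have /Une[l0 [[[fl0 _ _] fl0a] /andP[_ l0k]]] :=
  complete_filterI wc FU (complete_filterI wc FU UP Ua) (Uk _ o0k).
have ak : a < k by rewrite -fl0a; exact: lt_trans l0k.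
exfalso; apply: (weakly_compact_power ak).
(* The limit along [U] of the sets [(f l).2 x]; it equals [(f l).2 x] for almost all [l]. *)
pose i x := [set y | y < a /\ U [set l | (f l).2 x y]].
have Ui x : x < k -> U [set l | [/\ P l (f l), x < l & (f l).2 x = i x]].
  move=> xk.
  have UPa := complete_filterI wc FU (complete_filterI wc FU UP Ua) (Uk _ xk).
  have Uy : U [set l | forall y, y < a -> (f l).2 x y <-> i x y].
    apply: (Ucap _ (below a) (fun y => [set l | (f l).2 x y <-> i x y])).
      exact: (small_below wc ak).
    move=> y ya; have [|Uxy|Uxy] := dec (x, y).
    - by rewrite /= gt_max xk; exact: lt_trans ak.
    - by apply: (Usub _ _ _ Uxy) => l fxy; split=> // _; split.
    apply: (Usub _ _ _ Uxy) => l nfxy; split=> // -[_ Uxy'].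
    by have /Une[z []] := complete_filterI wc FU Uxy Uxy'.
  apply: Usub (complete_filterI wc FU UPa Uy).
  move=> l [[[Pl fla] /andP[xl _]] ly]; split=> //; apply/seteqP.
  have [_ fsub _] := Pl; split=> y.
    by move=> fxy; apply/ly => //; have := fsub _ xl _ fxy; rewrite /below /= fla.
  by move=> ixy; apply/ly => //; case: ixy.
apply: (@card_le_inj _ _ _ _ i) => [x _ y []//|x y xk yk ixy].
have /Une[l [[[_ _ finj] xl fx] [_ yl fy]]] := complete_filterI wc FU (Ui _ xk) (Ui _ yk).
by apply: finj => //; rewrite fx fy.
Qed.

Definition cofinal_map l a (f : O -> O) : Prop :=
  (forall x, x < a -> f x < l) /\ forall x, x < l -> exists2 y, y < a & x < f y.

(** Short cofinal maps into almost every [l] would have a constant domain [a] and, value by value, a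
    constant limit [b]. By completeness they agree with [b] on [a] almost everywhere, yet [b] is
    bounded on [a] by some [c < k]. *)
Lemma forced_regular : forced k (fun U => U [set l | forall a f, a < l ->
  ~ cofinal_map l a f]).
Proof.
have [o0 o0k] := wc_ex wc.
pose P l (af : O * (O -> O)) := af.1 < l /\ cofinal_map l af.1 af.2.
have /choice[f fP] l : exists af, (exists af, P l af) -> P l af.
  by have [[af afP]|naf] := pselect (exists af, P l af);
    [exists af|exists (l, fun=> l)].
pose bad l := exists af, P l af.
apply: forced_imp (forced_and wc
  (forced_regressive (fun _ : unit => fst \o f) (ranked_unit wc (a := o0)))
  (forced_and wc (forced_decide (fun _ : unit => bad) (ranked_unit wc (a := o0)))
    (forced_regressive (fun x l => (f l).2 x) (ranked_id wc)))).
move=> U FU [/(_ tt o0k) reg [/(_ tt o0k) decbad regf]].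
have [Usub Une Uk Ucap] := FU.
case: decbad => Ubad; last first.
  by apply: Usub Ubad => l nbad a h al cof; apply: nbad; exists (a, h).
have UP : U [set l | P l (f l)] by apply: Usub Ubad => l /fP.
have [|a Ua0] := reg; first by apply: (Usub _ _ _ UP) => l [].
have {Ua0}Ua : U [set l | (f l).1 = a] := Ua0.
have UPa := complete_filterI wc FU (complete_filterI wc FU UP Ua) (Uk _ o0k).
have /Une[l0 [[[fl0 _] fl0a] /andP[_ l0k]]] := UPa.
have ak : a < k by rewrite -fl0a; exact: lt_trans l0k.
have /choice[b bP] x : exists b, x < a -> b < k /\ U [set l | (f l).2 x = b].
  have [xa|nxa] := pselect (x < a); last by exists x.
  have Ux : U [set l | (f l).2 x < l < k].
    apply: Usub UPa => l [[[fl [fP1 _]] fla] /andP[_ lk]]; rewrite /= lk andbT.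
    by apply: fP1; rewrite fla.
  have [||b Ub] := regf x; first exact: lt_trans ak.
    by apply: Usub Ux => l /andP[].
  exists b => _; split=> //.
  by have /Une[l [/andP[fl lk] <-]] := complete_filterI wc FU Ux Ub; exact: lt_trans lk.
have Ub : U [set l | forall x, x < a -> (f l).2 x = b x].
  apply: (Ucap _ (below a) (fun x => [set l | (f l).2 x = b x])).
    exact: (small_below wc ak).
  by move=> x /bP[].
have [|c ck cP] := small_below wc ak (g := b); first by move=> x /bP[].
have /Une[l [[[[fl [_ cof]] fla] lb] /andP[cl _]]] :=
  complete_filterI wc FU (complete_filterI wc FU
    (complete_filterI wc FU UP Ua) Ub) (Uk _ ck).
have [y ya cy] := cof _ cl; rewrite fla in ya.
by rewrite lb // ltNge cP in cy.
Qed.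

Lemma forced_inaccessible : forced k (fun U => U inaccessible).
Proof.
have [o0 o0k] := wc_ex wc.
(* All [e n] lie below some [b' < k], so a cardinal above [b'] cannot be countable. *)
have [e [ek einj]] : exists e : nat -> O, (forall n, e n < k) /\ injective e.
  have /infiniteP/(card_le_injE o0)[e [ek einj]] := (uncountable_infinite wc.1).2.
  by exists e; split=> [n|m n]; [exact: ek|exact: einj].
have sN : small k [set: nat] by apply: small_countable.
have [b bk bP] := sN e (fun n _ => ek n).
apply: forced_imp (forced_and wc forced_power forced_regular) => U FU [Upow Ureg].
have [Usub _ Uk _] := FU; have [b' bb' b'k] := wc_limit wc bk.
apply: Usub (complete_filterI wc FU (complete_filterI wc FU Upow Ureg) (Uk _ b'k)).
move=> l [[lpow lreg] /andP[b'l _]].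
have cl : cardinal l.
  move=> a al; split; first by apply: subset_card_le => x xa; exact: lt_trans al.
  move=> la; apply: (lpow _ al); apply: card_le_trans la _.
  apply: (@card_le_inj _ _ _ _ (@set1 O)) => [x xa _ ->//|x y _ _ xy].
  by have : [set y] x by rewrite -xy.
have nl : ~ countable (below l).
  move=> cnt; apply: (cl _ b'l).2; apply: card_le_trans cnt _.
  apply: (@card_le_inj _ _ _ _ e) => [n _|m n _ _ /einj//].
  by apply: le_lt_trans bb'; exact: bP.
have il : infinite_cardinal l by apply: uncountable_infinite.
split=> //; split=> //.
  move=> X Xl Xunb [_ nlX].
  have [//|[a al /(card_le_injE o0)[h [ha hinj]]]] := card_le_total wfO X l.
  have [x0 Xx0 _] := Xunb _ b'l.
  (* [f] inverts the injection [h] of [X] into [below a], with default [x0] off its image; it is a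
     cofinal map from [a] to [l]. *)
  have /choice[f fP] y : exists x, X x /\ ((exists2 x, X x & h x = y) -> h x = y).
    have [[x Xx hx]|nx] := pselect (exists2 x, X x & h x = y); first by exists x.
    by exists x0.
  apply: (lreg a f al); split=> [y _|x /Xunb[y Xy /andP[xy _]]].
    exact: Xl (fP y).1.
  exists (h y); first exact: ha.
  by rewrite (hinj (f (h y)) y) //; [case: (fP (h y))|apply: (fP (h y)).2; exists y].
move=> m ml _; split; last exact: lpow.
have [lm|[a al ma]] := card_le_total wfO [set X : set O | X `<=` below m] l.
  by case: (lpow _ ml).
apply: card_le_trans ma _; apply: subset_card_le => x xa; exact: lt_trans al.
Qed.

End Forced.

(** * Reflection of stationary sets *)

Section Reflection.
Context {d : Order.disp_t} {O : orderType d}.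
Hypothesis wfO : well_founded (fun a b : O => a < b).
Variable k : O.
Hypothesis wc : weakly_compact k.
Implicit Types (a b l m : O) (C D X Y : set O) (U : set (set O)).

(* Along a normal filter, clubs D_l of l < k missing P_(x_l) would yield a fixed x
   and the club of all points a that lie in D_l for almost all l, which would
   miss P_x. *)
Lemma forced_stationary I (rk : I -> O) (Q : set I) (P : I -> set O) :
  ranked k rk -> (forall i, Q i -> rk i < k -> stationary_in (P i) k) ->
  forced k (fun U => U [set l | forall i, Q i -> rk i < l ->
    stationary_in (P i) l]).
Proof.
move=> rrk Pst; have [o0 o0k] := wc_ex wc.
pose bad l (iD : I * set O) := [/\ Q iD.1, rk iD.1 < l, club_in iD.2 l &
  forall x, iD.2 x -> ~ P iD.1 x].
have [[i0 _]|I0] := pselect (exists i : I, True); last first.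
  apply: forced_imp (forced_regressive (fun _ : unit => id) (ranked_unit wc (a := o0))).
  move=> U [Usub _ Uk _] _; apply: (Usub _ _ _ (Uk _ o0k)) => l _ i.
  by case: I0; exists i.
have /choice[f fP] l : exists iD, (exists iD, bad l iD) -> bad l iD.
  by have [[iD iDP]|niD] := pselect (exists iD, bad l iD);
    [exists iD|exists (i0, set0)].
have /choice[g gP] l : exists h : O -> O, bad l (f l) -> forall a, a < l ->
    (f l).2 (h a) /\ a < h a < l.
  have [[_ _ [_ Dunb _] _]|nbad] := pselect (bad l (f l)); last by exists id.
  have /choice[h hP] a : exists b, a < l -> (f l).2 b /\ a < b < l.
    have [/Dunb[b Db bP]|nal] := pselect (a < l); last by exists a.
    by exists b.
  by exists h.
apply: forced_imp (forced_and wc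
  (forced_regressive (fun _ : unit => fun l => rk (f l).1) (ranked_unit wc (a := o0)))
  (forced_and wc
    (forced_decide (fun _ : unit => [set l | exists iD, bad l iD])
      (ranked_unit wc (a := o0)))
    (forced_and wc (forced_decide (fun i => [set l | (f l).1 = i]) rrk)
      (forced_regressive (fun a l => g l a) (ranked_id wc))))).
move=> U FU [/(_ tt o0k) reg [/(_ tt o0k) decbad [deci regg]]].
have [Usub Une Uk Ucap] := FU.
case: decbad => Ubad; last first.
  apply: (Usub _ _ _ Ubad) => l nbad i Qi il C Cclub; apply: contrapT => nCP.
  by apply: nbad; exists (i, C); split=> // x Cx Px; apply: nCP; exists x.
have UP : U [set l | bad l (f l)] by apply: (Usub _ _ _ Ubad) => l /fP.
have [|b Ub] := reg; first by apply: (Usub _ _ _ UP) => l [].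
have bk : b < k.
  have /Une[l [[[_ fl _ _] flb] /andP[_ lk]]] :=
    complete_filterI wc FU (complete_filterI wc FU UP Ub) (Uk _ o0k).
  by rewrite /= in flb; rewrite -flb; exact: lt_trans lk.
(* The rank of the index is already fixed to [b]. Fewer than k indices have rank at most [b], so by
   completeness one of them occurs almost everywhere. *)
have [i Ui] : exists i, U [set l | (f l).1 = i].
  apply: contrapT => nUi.
  have Un : U [set l | forall i, rk i <= b -> (f l).1 <> i].
    apply: (Ucap _ [set i | rk i <= b] (fun i => [set l | (f l).1 <> i])).
      exact: rrk.
    move=> i ib; have [|Ui|//] := deci i; first exact: le_lt_trans bk.
    by case: nUi; exists i.
  by have /Une[l [/= <- /(_ (f l).1)]] := complete_filterI wc FU Ub Un; apply.
have UPi := complete_filterI wc FU UP Ui.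
have /Une[l0 [[[Qi rki _ _] fi] /andP[_ l0k]]] := complete_filterI wc FU UPi (Uk _ o0k).
rewrite /= in fi; rewrite fi in Qi rki.
have [|a [ak Ua] Pa] := Pst i Qi (lt_trans rki l0k)
    [set a | a < k /\ U [set l | (f l).2 a]]; last first.
  have /Une[l [[[_ _ _ nP] fli] Da]] := complete_filterI wc FU UPi Ua.
  by rewrite /= in fli; rewrite fli in nP; case: (nP _ Da Pa).
(* Unboundedness: the point [g l a] of the club at [l] lies between [a] and [l], hence is constant
   modulo [U]. Closedness: completeness puts the points [c x], for all [x < a], into almost every
   club at once. *)
split=> [a []//|a ak|a ak a0 aunb].
  have UPa := complete_filterI wc FU UP (Uk _ ak).
  have [||b' Ub'] := regg a; first exact: ak.
    by apply: (Usub _ _ _ UPa) => l [/gP lP /andP[/lP[_ /andP[]]]].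
  have Ub'' := complete_filterI wc FU UPa Ub'.
  have UD : U [set l | [/\ (f l).2 b', a < b' & b' < k]].
    apply: (Usub _ _ _ Ub'') => l [[/gP lP /andP[/lP[Dg /andP[ag gl]] lk]] <-].
    by split=> //; exact: lt_trans lk.
  have /Une[l [_ ab' b'k]] := UD.
  exists b'; last by rewrite ab'.
  by split=> //; apply: (Usub _ _ _ UD) => l' [].
split=> //.
have /choice[c cP] x : exists c, x < a -> U [set l | (f l).2 c] /\ x < c < a.
  have [/aunb[c [_ Uc] cP]|nxa] := pselect (x < a); last by exists x.
  by exists c.
have Uc : U [set l | forall x, x < a -> (f l).2 (c x)].
  apply: (Ucap _ (below a) (fun x => [set l | (f l).2 (c x)])).
    exact: (small_below wc ak).
  by move=> x /cP[].
have UPc := complete_filterI wc FU (complete_filterI wc FU UP Uc) (Uk _ ak).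
apply: (Usub _ _ _ UPc) => l [[[_ _ [_ _ Dcl] _] lc] /andP[al _]].
by apply: Dcl => // x xa; exists (c x); [exact: lc|case: (cP _ xa)].
Qed.

End Reflection.

(** * Meta-ordinal terms, their order and rank *)

Section Terms.
Context {d : Order.disp_t} {O : orderType d}.
Hypothesis wfO : well_founded (fun a b : O => a < b).
Implicit Types (s t : meta_term O) (k l a b : O) (X Y C : set O).

Lemma mt_seq_lt_cons e c e' c' (v w : seq (O * O)) :
  (((e', c') :: v : seqlexi (O *l O)) < (e, c) :: w) ->
  [\/ e' < e, e' = e /\ c' < c |
      [/\ e' = e, c' = c & (v : seqlexi (O *l O)) < w]].
Proof.
rewrite ltxi_cons !lexi_pair => /andP[/andP[e'e c'c] vw].
have [lte|gte|ee] := ltgtP e' e; [by constructor 1|by rewrite leNgt gte in e'e|].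
rewrite ee lexx /= in c'c vw.
have [ltc|gtc|cc] := ltgtP c' c.
- by constructor 2.
- by rewrite leNgt gtc in c'c.
by constructor 3; rewrite cc lexx in vw.
Qed.

(** As for Cantor normal forms, induction runs on the leading exponent, then its coefficient, then
    the tail. The tail is accessible because its exponents are smaller than the leading one; on
    arbitrary sequences the lexicographic order need not be well-founded. *)
Lemma mt_lt_wf : well_founded (fun s t : meta_term O => mt_lt s t).
Proof.
pose decr (w : seq (O * O)) := sorted (fun a b : O => b < a) (unzip1 w).
pose R (v w : seq (O * O)) := decr v /\ ((v : seqlexi (O *l O)) < w).
have R0 : Acc R [::] by constructor=> v [_]; rewrite ltxis0.
have Rcons e : forall c w, decr ((e, c) :: w) -> Acc R ((e, c) :: w).
  elim/(well_founded_ind wfO): e => e IHe.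
  have Rtail c w : decr ((e, c) :: w) -> Acc R w.
    case: w => [//|[e1 c1] w] /andP[e1e]; exact: IHe.
  move=> c; elim/(well_founded_ind wfO): c => c IHc w /[dup] /Rtail Rw.
  elim: Rw => {}w _ IHw dw; constructor=> -[//|[e' c'] v] [dv].
  case/mt_seq_lt_cons => [e'e|[ee c'c]|[ee cc vw]]; first exact: IHe.
    by rewrite ee in dv *; exact: IHc.
  by rewrite ee cc in dv *; apply: IHw => //; split=> //; exact: path_sorted dv.
move=> t; have : Acc R (mt_seq t).
  by case: (mt_seq t) (mt_exponents_decr t) => [//|[e c] w]; exact: Rcons.
move wt: (mt_seq t) => w Rw.
elim: Rw t wt => {}w _ IH t wt; constructor=> s st.
apply: (IH (mt_seq s)) => //; split; first exact: mt_exponents_decr.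
by move: st; rewrite /mt_lt wt.
Qed.

Lemma mt_seq_inj : injective (@mt_seq d O).
Proof.
move=> [v dv nv] [w dw nw] /= vw; case: w / vw dw nw => dw nw.
by congr MetaTerm; exact: Prop_irrelevance.
Qed.

(** It turns [ordinals_lt] into the rank condition of [forced_stationary]; [o0] is the rank of the
    term 0. *)
Definition mt_rank o0 t : O :=
  foldr (fun p => Order.max (Order.max p.1 p.2)) o0 (mt_seq t).

Lemma mt_rank_lt o0 t k : o0 < k -> (mt_rank o0 t < k) <-> ordinals_lt t k.
Proof.
move=> o0k; rewrite /mt_rank /ordinals_lt; elim: (mt_seq t) => [|p w IH] //=.
rewrite !gt_max; split=> [/andP[/andP[p1 p2] /IH wk] q|pw].
  by rewrite inE => /predU1P[->|/wk].
have [-> ->] := pw _ (mem_head p w); apply/IH => q qw.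
by apply: pw; rewrite inE qw orbT.
Qed.

Lemma small_preimage_inj k I J (h : I -> J) (A : set J) :
  weakly_compact k -> injective h -> small k A -> small k (h @^-1` A).
Proof.
move=> wc hinj sA g gk; have [o0 o0k] := wc_ex wc.
have /choice[g' g'P] j : exists a, a < k /\ forall i, h i = j -> A j -> a = g i.
  have [[i [<- Aj]]|ni] := pselect (exists i, h i = j /\ A j).
    by exists (g i); split=> [|i' /hinj ->//]; exact: gk.
  by exists o0; split=> // i ij Aj; case: ni; exists i.
have [|b bk bP] := sA g'; first by move=> j _; case: (g'P j).
exists b => // i Ai; have [_ /(_ i erefl Ai) <-] := g'P (h i).
exact: bP.
Qed.

Lemma ranked_mt_rank k o0 : weakly_compact k -> ranked k (mt_rank o0).
Proof.
move=> wc a ak; have rO := ranked_id wc.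
exact: small_preimage_inj wc mt_seq_inj (ranked_seq wc (ranked_pair wc rO rO) ak).
Qed.

Lemma stationary_in_sub X Y k : stationary_in X k ->
  (forall l, l < k -> X l -> Y l) -> stationary_in Y k.
Proof.
move=> Xst XY C Cclub; have [l Cl Xl] := Xst _ Cclub; exists l => //.
by apply: XY => //; case: Cclub => Ck _ _; exact: Ck.
Qed.

Lemma weakly_compact_mahlo k : weakly_compact k -> mahlo k.
Proof.
move=> wc; split=> [|C Cclub]; first by apply: uncountable_infinite; case: wc.
have [o0 o0k] := wc_ex wc.
have [U FU [Ui UC]] := forced_ex wfO wc
  (forced_and wc (forced_inaccessible wfO wc) (forced_club wc Cclub)).
have [_ Une Uk _] := FU.
have /Une[l [[il Cl] /andP[_ lk]]] :=
  complete_filterI wc FU (complete_filterI wc FU Ui UC) (Uk _ o0k).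
by exists l.
Qed.

End Terms.

Theorem theorem21 (d : Order.disp_t) (O : orderType d)
    (wfO : well_founded (fun a b : O => (a < b)%O))
    (k : O) (k_wc : weakly_compact k)
    (t : meta_term O) (t_k : ordinals_lt t k) :
  t_mahlo t k.
Proof.
have Mk := weakly_compact_mahlo wfO k_wc; have [o0 o0k] := wc_ex k_wc.
elim/(well_founded_ind (mt_lt_wf wfO)): t t_k => t IH tk.
constructor=> // s st sk C Cclub.
have /t_mahloE[_ _ sP] := IH s st sk.
(* [Fi] reflects the stationarity of the inaccessibles, to make [l] Mahlo; [Fs] reflects that of the
   r-Mahlo cardinals for all [r] below [s] at once. *)
have Fi := forced_stationary k_wc (ranked_unit k_wc (a := o0))
  (Q := setT) (P := fun=> [set l | l < k /\ inaccessible l]) (fun _ _ _ => Mk.2).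
have Fs := forced_stationary k_wc (ranked_mt_rank (o0 := o0) k_wc)
  (Q := [set r | mt_lt r s]) (P := fun r => [set l | l < k /\ t_mahlo r l])
  (fun r rs rk => sP r rs ((mt_rank_lt r o0k).1 rk)).
have [U FU [Ui [Umi [Ums UC]]]] := forced_ex wfO k_wc
  (forced_and k_wc (forced_inaccessible wfO k_wc)
    (forced_and k_wc Fi (forced_and k_wc Fs (forced_club k_wc Cclub)))).
have [_ Une Uk _] := FU.
have rk : mt_rank o0 s < k by apply/mt_rank_lt.
(* [l] is chosen above the rank of [s], so that the ordinals of [s] lie below it, and above [o0], so
   that [mt_rank_lt] applies at [l]. *)
have /Une[l [[[[[il mil] msl] Cl] /andP[sl lk]] /andP[o0l _]]] :=
  complete_filterI k_wc FU (complete_filterI k_wc FU (complete_filterI k_wc FU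
    (complete_filterI k_wc FU (complete_filterI k_wc FU Ui Umi) Ums) UC) (Uk _ rk))
    (Uk _ o0k).
exists l => //; split=> //; constructor.
- exact: (mt_rank_lt s o0l).1 sl.
- split; first by case: il => _ [].
  by apply: stationary_in_sub (mil tt I o0l) _ => x xl [].
move=> r rs /(mt_rank_lt r o0l) rl; apply: stationary_in_sub (msl r rs rl) _.
by move=> x xl [].
Qed.
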